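(* Let $p$ be a prime, let $m,n\ge1$ and $\ell\ge0$ be integers, and let $B\in\mathbb{F}_p^{m\times n}$ be a matrix with rows $\mathbf{b}_1,\dots,\mathbf{b}_m$ such that $B^T$ is a parity-check matrix of a code with distance greater than $2\ell+1$. Let $f_i:\mathbb{F}_p\to\{+1,-1\}$, $i=1,\dots,m$, be functions such that $|f_i^{-1}(+1)|=r$ for all $i$, for some $r\in\{1,\dots,p-1\}$. Let $\mathbf{x}$ be uniformly distributed on $\mathbb{F}_p^n$. Let $s_i$ be the random variable with $s_i=0$ if $f_i(\mathbf{b}_i\cdot\mathbf{x})=-1$ and $s_i=1$ otherwise. Let $S=s_1+\cdots+s_m$ and let $N(s)=\Pr[S=s]$. Let $N_{\mathrm{binom}}(s)=\binom{m}{s}\left(\frac rp\right)^s\left(1-\frac rp\right)^{m-s}$ be the binomial distribution with mean $m\frac rp$ and variance $m\frac rp\left(1-\frac rp\right)$. Then for every polynomial $P(s)$ of degree at most $2\ell$, normalized so that $\sum_{s=0}^mP(s)N(s)=1$, $$\langle s\rangle_{s\sim P(s)N(s)}=\langle s\rangle_{s\sim P(s)N_{\mathrm{binom}}(s)},$$ that is, $$\sum_{s=0}^m s\,P(s)\,N(s)=\sum_{s=0}^m s\,P(s)\,N_{\mathrm{binom}}(s).$$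
   Context: ''$B^T$ is a parity-check matrix of a code with distance greater than $2\ell+1$'' means that the linear code $\{\mathbf{y}\in\mathbb{F}_p^m : B^T\mathbf{y}=\mathbf{0}\}$ has minimum Hamming distance greater than $2\ell+1$, i.e. every nonzero $\mathbf{y}$ in it has more than $2\ell+1$ nonzero entries. For a weight function $W$ on $\{0,\dots,m\}$, the notation $\langle s\rangle_{s\sim W(s)}$ denotes $\sum_{s=0}^m s\,W(s)$. *)

(* Defs.v *)
From HB Require Import structures.
From mathcomp Require Import all_boot all_order all_algebra.
Set Implicit Arguments.
Unset Strict Implicit.
Unset Printing Implicit Defensive.
Import GRing.Theory.
Local Open Scope ring_scope.

(** Linear codes *)

Definition hamming_weight (F : fieldType) (m : nat) (y : 'cV[F]_m) : nat :=
  #|[set i : 'I_m | y i 0 != 0]|.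

Definition code_of_parity_check (F : finFieldType) (k m : nat)
    (H : 'M[F]_(k, m)) : {set 'cV[F]_m} :=
  [set y : 'cV[F]_m | H *m y == 0].

(** The minimum distance of a linear code is the least weight of a nonzero
    codeword; the zero code has distance greater than every [d]. *)
Definition distance_gt (F : finFieldType) (m : nat) (C : {set 'cV[F]_m})
    (d : nat) : Prop :=
  forall y : 'cV[F]_m, y \in C -> y != 0 -> (d < hamming_weight y)%N.

(** Probability of the event [E] under the uniform distribution on [T] *)
Definition unif_prob (R : numFieldType) (T : finType) (E : {set T}) : R :=
  #|E|%:R / #|T|%:R.

(** The random variables [s_i] and [S], as functions of the sample point [x].
    [(B *m x) i 0] is the product of the [i]-th row of [B] with [x]; the
    signs +1 and -1 are integers. *)
Definition sat_ind (p m n : nat) (B : 'M['F_p]_(m, n))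
    (f : 'I_m -> 'F_p -> int) (i : 'I_m) (x : 'cV['F_p]_n) : nat :=
  if f i ((B *m x) i 0) == -1 then 0%N else 1%N.

Definition sat_count (p m n : nat) (B : 'M['F_p]_(m, n))
    (f : 'I_m -> 'F_p -> int) (x : 'cV['F_p]_n) : nat :=
  (\sum_(i < m) sat_ind B f i x)%N.

Definition sat_distr (R : numFieldType) (p m n : nat) (B : 'M['F_p]_(m, n))
    (f : 'I_m -> 'F_p -> int) (s : nat) : R :=
  unif_prob R [set x : 'cV['F_p]_n | sat_count B f x == s].

Definition binom_distr (R : numFieldType) (m : nat) (q : R) (s : nat) : R :=
  'C(m, s)%:R * q ^+ s * (1 - q) ^+ (m - s).

(** Mean of [s] with respect to a weight function on {0, ..., m}, which need
    not be nonnegative or of total mass 1 *)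
Definition weighted_mean (R : numFieldType) (m : nat) (W : nat -> R) : R :=
  \sum_(0 <= s < m.+1) s%:R * W s.

(* Main.v *)
Require Import Defs.
From HB Require Import structures.
From mathcomp Require Import all_boot all_order all_algebra.
From mathcomp Require Import ring.
Set Implicit Arguments.
Unset Strict Implicit.
Unset Printing Implicit Defensive.
Import GRing.Theory.
Local Open Scope ring_scope.

(** With [Q = 'X * P], of degree at most [2l + 1], both sides are means of
    [Q(s)], and these agree once the factorial moments of order
    [k <= 2l + 1] do.  For the sampled [S], the binomial coefficient ['C(S, k)]
    counts the [k]-sets [T] of constraints that are all satisfied.  A linear
    relation among the rows of [B] is a codeword of the code with parity check
    matrix [B^T], so any [k <= 2l + 1] rows are independent and every such [T]
    is satisfied with probability [(r/p)^k], as for the binomial law. *)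

(** The identity [s * s ^_ k = s ^_ k.+1 + k * s ^_ k] trades one power of [s] for falling
    factorials of order at most one higher. Induction on [j] thus kills every mixed moment of
    [s ^ j * s ^_ k] with [j + k <= d], and [k = 0] gives the monomials of [Q]. *)
Lemma falling_moments_vanish (R : numFieldType) (m d : nat) (W : nat -> R) :
  (forall k, (k <= d)%N -> \sum_(0 <= s < m.+1) (s ^_ k)%:R * W s = 0) ->
  forall Q : {poly R}, (size Q <= d.+1)%N ->
    \sum_(0 <= s < m.+1) Q.[s%:R] * W s = 0.
Proof.
move=> W0 Q sQ.
have mixed j : forall k, (j + k <= d)%N ->
    \sum_(0 <= s < m.+1) s%:R ^+ j * (s ^_ k)%:R * W s = 0.
  elim: j => [|j IHj] k lejk.
    by under eq_bigr => s _ do rewrite expr0 mul1r; exact: W0.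
  have step s : (s * s ^_ k = s ^_ k.+1 + k * s ^_ k)%N.
    (* [s ^_ k.+1 = s ^_ k * (s - k)] uses truncated subtraction, so [s < k] is treated apart; there
       every term is 0. *)
    have [leks|ltsk] := leqP k s.
      by rewrite ffactnSr [(k * _)%N]mulnC -mulnDr subnK // mulnC.
    by rewrite !ffact_small ?muln0 // ltnW.
  transitivity (\sum_(0 <= s < m.+1) s%:R ^+ j * (s ^_ k.+1)%:R * W s
      + k%:R * \sum_(0 <= s < m.+1) s%:R ^+ j * (s ^_ k)%:R * W s).
    rewrite mulr_sumr -big_split /=; apply: eq_bigr => s _.
    rewrite exprSr -[_ * _ * (s ^_ k)%:R]mulrA -natrM step natrD natrM; ring.
  by rewrite !IHj ?mulr0 ?addr0 // ?addnS // ltnW.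
under eq_bigr => s _ do rewrite horner_coef mulr_suml.
rewrite exchange_big big1 //= => j _.
transitivity (Q`_j * \sum_(0 <= s < m.+1) s%:R ^+ j * (s ^_ 0)%:R * W s).
  by rewrite mulr_sumr; apply: eq_bigr => s _; rewrite ffactn0 mulr1 mulrA.
by rewrite mixed ?mulr0 // addn0 -ltnS (leq_trans _ sQ).
Qed.

Lemma coef_exp_1DaX (R : comNzRingType) (a : R) (m k : nat) :
  ((1 + a *: 'X) ^+ m)`_k = 'C(m, k)%:R * a ^+ k.
Proof.
rewrite exprDn coef_sum.
under eq_bigr => i _ do
  rewrite expr1n mul1r exprZn coefMn coefZ coefXn.
have [ltkm|ltmk] := ltnP k m.+1.
  rewrite (bigD1 (Ordinal ltkm)) //= eqxx mulr1 mulr_natl big1 ?addr0 // => i neq_ik.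
  by rewrite eq_sym (negPf neq_ik : (i == k :> nat) = false) mulr0 mul0rn.
rewrite bin_small // mul0r big1 // => i _.
by rewrite gtn_eqF ?mulr0 ?mul0rn // (leq_trans (ltn_ord i)).
Qed.

(** Generating function at [1 + 'X]: the sum of [binom_distr m q s] times [(1 + 'X) ^+ s] is [(1 - q
    + q (1 + 'X)) ^+ m = (1 + q 'X) ^+ m]. Compare coefficients of ['X^k]. *)
Lemma binom_distr_factorial_moment (R : numFieldType) (m k : nat) (q : R) :
  \sum_(0 <= s < m.+1) 'C(s, k)%:R * binom_distr m q s = 'C(m, k)%:R * q ^+ k.
Proof.
rewrite -coef_exp_1DaX.
have -> : 1 + q *: 'X = (1 - q)%:P + q *: (1 + 1 *: 'X) :> {poly R}.
  by rewrite -!mul_polyC polyCB polyC1; ring.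
rewrite exprDn coef_sum big_mkord; apply: eq_bigr => s _.
rewrite exprZn -polyC_exp mul_polyC coefMn !coefZ coef_exp_1DaX expr1n.
rewrite /binom_distr -mulr_natl; ring.
Qed.

(** A right inverse [D] of [M] makes the fiber over [z] the translate by [D *m z] of the kernel, so
    all fibers have the same size. The product form avoids division. *)
Lemma card_fiber_row_free (F : finFieldType) (k n : nat) (M : 'M[F]_(k, n))
    (V : {set 'cV[F]_k}) : row_free M ->
  (#|[set x : 'cV[F]_n | M *m x \in V]| * #|F| ^ k = #|V| * #|F| ^ n)%N.
Proof.
move=> /row_freeP[D MD1].
have fiber z : #|[set x : 'cV[F]_n | M *m x == z]|
             = #|[set x : 'cV[F]_n | M *m x == 0]|.
  rewrite -[RHS](card_imset _ (@addrI _ (D *m z))); apply: eq_card => x.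
  apply/idP/imsetP => [|[y]]; rewrite !inE.
    move=> /eqP Mx; exists (x - D *m z); last by rewrite addrC subrK.
    by rewrite inE mulmxBr mulmxA MD1 mul1mx Mx subrr.
  by move=> /eqP My ->; rewrite mulmxDr mulmxA MD1 mul1mx My addr0.
have count (U : {set 'cV[F]_k}) : #|[set x : 'cV[F]_n | M *m x \in U]|
    = (#|U| * #|[set x : 'cV[F]_n | M *m x == 0%R]|)%N.
  rewrite -sum_nat_const -sum1_card (partition_big (mulmx M) (mem U)) /=.
    apply: eq_bigr => z Uz; rewrite -(fiber z) -sum1_card.
    by apply: eq_bigl => x; rewrite !inE; case: eqP => [->|]; rewrite ?Uz ?andbF.
  by move=> x; rewrite inE.
(* Taking the whole space as target determines the common fiber size. *)
have := count setT.
have -> : [set x : 'cV[F]_n | M *m x \in setT] = setT.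
  by apply/setP => x; rewrite !inE.
rewrite !cardsT !card_mx !muln1 => ->; rewrite count; ring.
Qed.

Lemma card_cV_family (F : finType) (k : nat) (A : 'I_k -> {set F}) :
  #|[set z : 'cV[F]_k | [forall i, z i 0 \in A i]]| = (\prod_i #|A i|)%N.
Proof.
pose phi (g : {ffun 'I_k -> F}) : 'cV[F]_k := \col_i g i.
have phiI : injective phi.
  by move=> g h /colP e; apply/ffunP => i; have := e i; rewrite !mxE.
transitivity #|family (fun i => mem (A i))|; last first.
  by rewrite card_family /image_mem foldrE big_map big_enum.
rewrite -(card_imset _ phiI); apply: eq_card => z; rewrite inE.
apply/forallP/imsetP => [zA|[g /familyP gA ->] i]; last by rewrite mxE gA.
exists [ffun i => z i 0]; first by apply/familyP => i; rewrite ffunE zA.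
by apply/colP => i; rewrite mxE ffunE.
Qed.

(** The coefficients of a vanishing combination of the chosen rows, padded with zeros, form a
    codeword of weight at most [k <= d], which must be zero. *)
Lemma distance_gt_row_free (F : finFieldType) (m n d k : nat)
    (B : 'M[F]_(m, n)) (e : 'I_k -> 'I_m) :
  distance_gt (code_of_parity_check B^T) d -> injective e -> (k <= d)%N ->
  row_free (rowsub e B).
Proof.
move=> Bd eI lekd; apply: inj_row_free => v vB0.
(* [rowsub e 1%:M] is a selection matrix: [y] has entry [v 0 j] at [e j], and 0 off the image of
   [e]. *)
pose y : 'cV[F]_m := (v *m rowsub e 1%:M)^T.
have yC : y \in code_of_parity_check B^T.
  by rewrite inE -trmx_mul -mulmxA mul_rowsub_mx mul1mx vB0 trmx0.
have ye j : y (e j) 0 = v 0 j.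
  rewrite !mxE (bigD1 j) //= !mxE eqxx mulr1 big1 ?addr0 // => i neq_ij.
  by rewrite !mxE (inj_eq eI) (negPf neq_ij) mulr0.
have [y0|yN0] := eqVneq y 0.
  by apply/rowP => j; rewrite -ye y0 !mxE.
have := Bd y yC yN0; rewrite ltnNge (leq_trans _ lekd) // /hamming_weight.
rewrite -[k]card_ord -cardsT -(card_imset _ eI).
apply/subset_leq_card/subsetP => i; rewrite inE; apply: contraNT => iNe.
rewrite !mxE big1 // => j _; rewrite !mxE; case: eqP => [ji|_]; last by rewrite mulr0.
by rewrite -ji imset_f in iNe.
Qed.

Lemma sum_sat_distr (R : numFieldType) (p m n : nat) (B : 'M['F_p]_(m, n))
    (f : 'I_m -> 'F_p -> int) (g : nat -> R) :
  \sum_(0 <= s < m.+1) g s * sat_distr R B f s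
  = (\sum_x g (sat_count B f x)) / #|{: 'cV['F_p]_n}|%:R.
Proof.
have le_count x : (sat_count B f x < m.+1)%N.
  rewrite ltnS /sat_count -[m in leqRHS]card_ord -sum1_card leq_sum // => i _.
  by rewrite /sat_ind; case: ifP.
rewrite (partition_big (fun x => Ordinal (le_count x)) predT) //= mulr_suml.
rewrite big_mkord; apply: eq_bigr => s _.
rewrite /sat_distr /unif_prob mulrA -sum1_card natr_sum mulr_sumr.
congr (_ / _); apply: eq_big => x; first by rewrite inE -(inj_eq val_inj).
by rewrite inE mulr1 => /eqP ->.
Qed.

Lemma sat_distr_factorial_moment (R : numFieldType) (p m n d r k : nat)
    (B : 'M['F_p]_(m, n)) (f : 'I_m -> 'F_p -> int) :
  prime p -> distance_gt (code_of_parity_check B^T) d ->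
  (forall i a, f i a = 1 \/ f i a = -1) ->
  (forall i, #|[set a : 'F_p | f i a == 1]| = r) -> (k <= d)%N ->
  \sum_(0 <= s < m.+1) 'C(s, k)%:R * sat_distr R B f s
  = 'C(m, k)%:R * (r%:R / p%:R) ^+ k.
Proof.
move=> p_prime Bd f_sign f_card lekd; rewrite sum_sat_distr.
pose A (x : 'cV['F_p]_n) := [set i | f i ((B *m x) i 0) == 1].
have countE x : sat_count B f x = #|A x|.
  rewrite -sum1_card /sat_count big_mkcond [in RHS]big_mkcond.
  by apply: eq_bigr => i _; rewrite /sat_ind inE;
     case: (f_sign i ((B *m x) i 0)) => ->.
have binE x : 'C(sat_count B f x, k)
    = (\sum_(T : {set 'I_m} | #|T| == k) (T \subset A x))%N.
  rewrite countE -cards_draws -sum1_card big_mkcond [in RHS]big_mkcond /=.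
  by apply: eq_bigr => T _; rewrite inE andbC; case: eqP; case: subsetP.
have p0 : p%:R != 0 :> R by rewrite Num.Theory.pnatr_eq0 -lt0n prime_gt0.
(* Cross-multiplied form of: all constraints in [T] hold with probability [(r/p)^k]. The selected
   rows are independent, and the admissible values form a product of [k] sets of size [r]. *)
have cardT (T : {set 'I_m}) : #|T| == k ->
    ((\sum_x (T \subset A x)) * p ^ k = r ^ k * p ^ n)%N.
  move=> /eqP Tk; rewrite -Tk.
  pose e := @enum_val _ (mem T).
  have freeT : row_free (rowsub e B).
    by apply: (distance_gt_row_free Bd (@enum_val_inj _ _)); rewrite Tk.
  pose V := [set z : 'cV['F_p]_#|T| |
    [forall j, z j 0 \in [set a | f (e j) a == 1]]].
  have := card_fiber_row_free V freeT.
  rewrite /V card_cV_family card_Fp //.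
  under eq_bigr => j _ do rewrite f_card.
  rewrite prod_nat_const card_ord => <-; congr (_ * _)%N.
  rewrite -sum1_card [in RHS]big_mkcond; apply: eq_bigr => x _.
  rewrite !inE mul_rowsub_mx.
  have -> : (T \subset A x) =
      [forall j, rowsub e (B *m x) j 0 \in [set a | f (e j) a == 1]].
    apply/subsetP/forallP => [TA j | TA i iT].
      by have := TA (e j) (enum_valP j); rewrite !inE !mxE.
    by have := TA (enum_rank_in iT i); rewrite !inE !mxE /e enum_rankK_in.
  by case: ifP.
rewrite card_mx card_Fp // muln1.
under eq_bigr => x _ do rewrite binE.
rewrite -natr_sum exchange_big /= natrX.
have -> : 'C(m, k) = (\sum_(T : {set 'I_m} | #|T| == k) 1)%N.
  by rewrite sum1dep_card card_draws card_ord.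
rewrite !natr_sum !mulr_suml; apply: eq_bigr => T /cardT /(congr1 (fun a => a%:R : R)).
rewrite !natrM !natrX expr_div_n mul1r => eT.
by apply/eqP; rewrite eqr_div ?expf_neq0 // eT.
Qed.

Theorem claim10 (R : numFieldType) (p m n l r : nat)
    (p_prime : prime p) (m_ge1 : (1 <= m)%N) (n_ge1 : (1 <= n)%N)
    (B : 'M['F_p]_(m, n))
    (B_dist : distance_gt (code_of_parity_check (B^T)) (2 * l + 1))
    (f : 'I_m -> 'F_p -> int)
    (f_sign : forall (i : 'I_m) (a : 'F_p), f i a = 1 \/ f i a = -1)
    (r_range : (1 <= r <= p - 1)%N)
    (f_card : forall i : 'I_m, #|[set a : 'F_p | f i a == 1]| = r)
    (P : {poly R}) (P_deg : (size P <= (2 * l).+1)%N)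
    (P_norm : \sum_(0 <= s < m.+1) P.[s%:R] * sat_distr R B f s = 1) :
  weighted_mean m (fun s : nat => P.[s%:R] * sat_distr R B f s) =
  weighted_mean m (fun s : nat => P.[s%:R] * binom_distr m (r%:R / p%:R) s).
Proof.
apply/eqP; rewrite -subr_eq0 -sumrB; apply/eqP.
pose W s := sat_distr R B f s - binom_distr m (r%:R / p%:R) s.
(* The factor [s] of the mean raises the degree from [2l] to [2l + 1], which the distance bound
   still covers. *)
transitivity (\sum_(0 <= s < m.+1) (P * 'X).[s%:R] * W s).
  by apply: eq_bigr => s _; rewrite hornerMX /W; ring.
apply: (@falling_moments_vanish _ _ (2 * l + 1)); last first.
  by rewrite (leq_trans (size_polyMleq _ _)) // size_polyX !addn2 addn1 ltnS.
move=> k lek.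
(* Since [s ^_ k] is [k!] times ['C(s, k)], falling moments reduce to the binomial moments computed
   above. *)
transitivity (k`!%:R *
  (\sum_(0 <= s < m.+1) 'C(s, k)%:R * sat_distr R B f s -
   \sum_(0 <= s < m.+1) 'C(s, k)%:R * binom_distr m (r%:R / p%:R) s)).
  rewrite -sumrB mulr_sumr; apply: eq_bigr => s _.
  by rewrite -bin_ffact natrM /W; ring.
rewrite binom_distr_factorial_moment.
by rewrite (sat_distr_factorial_moment R p_prime B_dist f_sign f_card lek) subrr mulr0.
Qed.
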